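(* Let $J = \{J_l : 1 \le l \le N\}$ be a partition of $\mathbb{T}$ into finitely many intervals, each of length strictly less than $1/2$. Suppose that $\alpha \in \mathbb{T}$ has bounded partial quotients. Then $R(s(\alpha,\beta,\gamma,J)) = T(s(\alpha,\beta,\gamma,J)) = 1$ for every $(\beta,\gamma) \in \mathbb{T}^2$.
   Context: $\mathbb{T} = \mathbb{R}/\mathbb{Z}$, and $\langle x \rangle = \mathrm{dist}(x,\mathbb{Z})$. $\alpha$ has bounded partial quotients if it is irrational and the coefficients in its continued fraction expansion are bounded; equivalently, $\inf_{q \ge 1} q \langle q\alpha \rangle > 0$ ($q$ ranging over positive integers). For $(\alpha,\beta,\gamma) \in \mathbb{T}^3$, $s(\alpha,\beta,\gamma,J) = (s_n)_{n\in\mathbb{Z}}$ denotes the coding of $\alpha n^2 + \beta n + \gamma$ (in $\mathbb{T}$) with respect to $J$, i.e. $s_n = \sum_{l=1}^N \lambda_l \chi_{J_l}(\alpha n^2 + \beta n + \gamma)$ with distinct numbers $\lambda_1,\ldots,\lambda_N$. For a two-sided sequence $\omega = (\omega_k)_{k\in\mathbb{Z}}$ over a finite alphabet and $n \ge 1$, let $R_n(\omega) = 1 + \frac{1}{n} \sup \{ m : \omega_k = \omega_{k+n} \text{ for } 1 \le k \le m \}$ and $T_n(\omega) = 1 + \frac{1}{n} \sup \{ m : \omega_k = \omega_{k+n} \text{ and } \omega_{n+1-k} = \omega_{1-k} \text{ for } 1 \le k \le m \}$, where $m$ ranges over positive integers and $\sup\emptyset = 0$; set $R(\omega) = \limsup_{n\to\infty}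 R_n(\omega)$ and $T(\omega) = \limsup_{n\to\infty} T_n(\omega)$, elements of $[1,\infty]$. *)

(* Defs.v *)
From HB Require Import structures.
From mathcomp Require Import all_boot all_order all_algebra.
From mathcomp Require Import boolp classical_sets functions reals ereal.
From mathcomp Require Import topology normedtype sequences numfun.

Set Implicit Arguments.
Unset Strict Implicit.
Unset Printing Implicit Defensive.

Import Order.TTheory GRing.Theory Num.Theory.

Local Open Scope classical_set_scope.
Local Open Scope quotient_scope.
Local Open Scope ring_scope.

(* [Num.int] as a subgroup of R; [Num.int_num_subdef] is its underlying
   predicate. *)
Definition integers (R : realType) : zmodClosed R :=
  GRing.ZmodClosed.clone R (@Num.int_num_subdef R) _.

Definition circle (R : realType) : Type := Quotient.quot (integers R).
HB.instance Definition _ (R : realType) := GRing.Zmodule.on (circle R).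

Definition to_circle (R : realType) (x : R) : circle R :=
  \pi_(Quotient.quot (integers R)) x.

Lemma eq_to_circle (R : realType) (x y : R) :
  to_circle x = to_circle y <-> x - y \is a Num.int.
Proof.
rewrite /to_circle; split=> [/eqP|xy]; last apply/eqP.
  by rewrite -Quotient.idealrBE.
by rewrite -Quotient.idealrBE.
Qed.

Lemma to_circleD (R : realType) (x y : R) :
  to_circle (x + y) = to_circle x + to_circle y.
Proof. exact: (Quotient.pi_add (integers R)). Qed.

(* The bound on [len] makes [len] the actual length of the projected set (an
   interval of length 1 or more projects onto the circle up to one point).
   The booleans [ba], [bb] choose open or closed ends, independently. *)
Definition is_arc (R : realType) (A : set (circle R)) (len : R) : Prop :=
  0 <= len <= 1 /\
  exists (a : R) (ba bb : bool),
    A = @to_circle R @` [set` Interval (BSide ba a) (BSide bb (a + len))].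

(* The complete quotients x_0 = x, x_(k+1) = 1 / (x_k - floor x_k); meaningful
   for every k only when x is irrational. *)
Definition complete_quotient (R : realType) (x : R) (k : nat) : R :=
  iter k (fun y : R => (y - (Num.floor y)%:~R)^-1) x.

Definition partial_quotient (R : realType) (x : R) (k : nat) : int :=
  Num.floor (complete_quotient x k).

(* Translating x by an integer changes only the partial quotient of index 0,
   so the choice of the representative is immaterial. *)
Definition bounded_partial_quotients (R : realType) (alpha : circle R) : Prop :=
  exists x : R,
    [/\ to_circle x = alpha,
        irrational x &
        exists M : int, forall k : nat, partial_quotient x k <= M].

Definition quadratic_coding (R : realType) (N : nat)
    (J : 'I_N -> set (circle R)) (lambda : 'I_N -> R)
    (alpha beta gamma : circle R) (n : int) : R :=
  \sum_(l < N) lambda l * \1_(J l) (alpha *~ (n ^+ 2) + beta *~ n + gamma).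

(* [maxe 0] implements the convention that the supremum of the empty set is 0
   (it is -oo in \bar R). *)
Definition sup_pos (R : realType) (P : nat -> Prop) : \bar R :=
  maxe 0%E (ereal_sup [set (m%:R)%:E | m in [set m : nat | (0 < m)%N /\ P m]]).

Definition Rn (R : realType) (A : Type) (omega : int -> A) (n : nat) : \bar R :=
  (1 + (n%:R^-1)%:E *
    sup_pos R (fun m => forall k : int, (1 <= k <= m%:Z)%R ->
      omega k = omega (k + n%:Z)%R))%E.

Definition Tn (R : realType) (A : Type) (omega : int -> A) (n : nat) : \bar R :=
  (1 + (n%:R^-1)%:E *
    sup_pos R (fun m => forall k : int, (1 <= k <= m%:Z)%R ->
      omega k = omega (k + n%:Z)%R /\
      omega (n%:Z + 1 - k)%R = omega (1 - k)%R))%E.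

Definition R_exponent (R : realType) (A : Type) (omega : int -> A) : \bar R :=
  limn_esup (Rn R omega).

Definition T_exponent (R : realType) (A : Type) (omega : int -> A) : \bar R :=
  limn_esup (Tn R omega).

(* Main.v *)
Require Import Defs.
From HB Require Import structures.
From mathcomp Require Import all_boot all_order all_algebra.
From mathcomp Require Import boolp classical_sets functions reals ereal.
From mathcomp Require Import topology normedtype sequences numfun.
From mathcomp Require Import ring lra zify.

Set Implicit Arguments.
Unset Strict Implicit.
Unset Printing Implicit Defensive.

Import Order.TTheory GRing.Theory Num.Theory.

Local Open Scope classical_set_scope.
Local Open Scope ring_scope.

(** Write x_k = alpha k^2 + beta k + gamma.  Every window counted by T_n is
    counted by R_n, and both exponents are at least 1, so it is enough to find,
    for each eps > 0 and all large n, some k <= eps n for which x_k and x_(k+n)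
    lie in different intervals.

    The difference x_(k+n) - x_k = 2 alpha n k + const is an orbit of the
    rotation by theta = 2 alpha n.  Suppose that x_k and x_(k+n) share an
    interval for all k <= eps n.  Then this orbit stays in [-c, c] mod 1, where
    c < 1/2 bounds the lengths of the intervals, so it never enters an arc of
    length 1 - 2c.  By Dirichlet's theorem some q, bounded in terms of c alone,
    makes q theta shorter mod 1 than that arc, and a step shorter than the
    forbidden arc cannot jump over it: along every progression of difference q
    the lifts of the differences to [-c, c] form an honest arithmetic
    progression (confined_rotation).  Taking W = Q! as a common multiple of all
    possible q, the differences at k = 1 + W j are E_j = E_0 + j sigma for
    j up to J of order n.

    Boundedness gives |sigma| = O(1/n).  Bounded partial quotients
    (bounded_quotients_badly_approximable) give |sigma| >= const / n.  Hence
    E_j drifts by a fixed amount, and at one of the two ends of the range it is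
    at least delta in absolute value, with delta independent of n, and nearly
    constant over any fixed number L of consecutive j.

    Along the same j, x_(1 + W j) is a quadratic sequence with the fixed leading
    coefficient alpha W^2, so L of its consecutive terms suffice to meet a
    prescribed short arc, whatever the lower coefficients are (quadratic_hits).
    Aim it, or its translate x_(1 + W j + n) if E_j < 0, at the part of one of
    the intervals within delta / 2 of its right end: adding |E_j|, which lies
    between delta / 2 and 1/2, then leaves that interval, whose length is less
    than 1/2.  This contradicts the assumption (separated_pair). *)

(** * Bounded partial quotients and badly approximable numbers *)

Definition badly_approximable (R : realType) (x kappa : R) : Prop :=
  0 < kappa /\
  forall (q : nat) (p : int), (0 < q)%N ->
    kappa <= q%:R * `|q%:R * x - p%:~R|.

Definition frac_part (R : realType) (x : R) : R := x - (Num.floor x)%:~R.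

Lemma frac_part_itv (R : realType) (x : R) : 0 <= frac_part x < 1.
Proof.
rewrite /frac_part; have /andP[h1] := floor_itv x.
by rewrite intrD => h2; lra.
Qed.

Lemma irrational_inv_sub_int (R : realType) (x : R) (z : int) :
  irrational x -> irrational (x - z%:~R)^-1.
Proof.
move=> irrx [r _ rE]; apply: irrx; exists (r^-1 + z%:~R) => //.
by rewrite rmorphD /= fmorphV /= rE invrK ratr_int subrK.
Qed.

Lemma irrational_complete_quotient (R : realType) (x : R) k :
  irrational x -> irrational (complete_quotient x k).
Proof.
by move=> irrx; elim: k => [//|k IH]; apply: irrational_inv_sub_int.
Qed.

Lemma frac_part_gt0 (R : realType) (x : R) : irrational x -> 0 < frac_part x.
Proof.
move=> irrx; have /andP[h _] := frac_part_itv x.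
rewrite lt_neqAle h andbT eq_sym subr_eq0; apply/eqP => xE; apply: irrx.
by exists (Num.floor x)%:~R => //; rewrite ratr_int.
Qed.

Section BoundedQuotients.
Variables (R : realType) (x : R) (M : int).
Hypothesis x_irr : irrational x.
Hypothesis x_bound : forall k, partial_quotient x k <= M.

Let f k := frac_part (complete_quotient x k).
Let a k : R := (partial_quotient x k)%:~R.

Lemma frac_complete_quotientS k :
  [/\ 0 < f k, 1 <= a k.+1, a k.+1 <= M%:~R, 0 <= f k.+1 < 1
    & f k * (a k.+1 + f k.+1) = 1].
Proof.
have f0 : 0 < f k by apply/frac_part_gt0/irrational_complete_quotient.
have /andP[_ f1] : 0 <= f k < 1 by exact: frac_part_itv.
have E : (f k)^-1 = a k.+1 + f k.+1.
  by rewrite /a /f {2}/frac_part /partial_quotient [RHS]addrC subrK.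
split=> //.
- rewrite -[1]/(1%:~R) ler_int floor_ge_int.
  by rewrite -[complete_quotient _ _]/((f k)^-1) invf_ge1 // ltW.
- by rewrite ler_int.
- exact: frac_part_itv.
- by rewrite -E divff // gt_eqF.
Qed.

Lemma partial_quotient_bound_ge1 : 1 <= M%:~R :> R.
Proof. by have [_ h1 h2 _ _] := frac_complete_quotientS 0; lra. Qed.

(** The form |q f - p| (q + p y) / (1 + f y) is preserved by one step of the
    continued fraction algorithm, f = 1 / (a + f'), y' = 1 / (a + y),
    (q, p) |-> (p, q - a p), where y records the partial quotients already
    consumed.  Descending on q + p, it is enough to bound it from below where
    the descent stops: at p = 0 or when q - a p < 0.  Keeping y general makes
    the induction lose nothing; the application has y = 0. *)
Lemma continued_fraction_form_lb (n k q p : nat) (y : R) :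
  (q + p <= n)%N -> (0 < q)%N -> 0 <= y <= 1 ->
  (1 + f k * y) / (2 * (M%:~R + 1)) <=
    `|q%:R * f k - p%:R| * (q%:R + p%:R * y).
Proof.
have M1 := partial_quotient_bound_ge1.
elim: n k q p y => [|n IH] k q p y; first by lia.
move=> qpn q0 /andP[y0 y1].
have [f0 a1 aM /andP[g0 g1] fE] := frac_complete_quotientS k.
have q1 : 1 <= q%:R :> R by rewrite ler1n.
have den0 : 0 < 2 * (M%:~R + 1) :> R by lra.
have p0 : 0 <= p%:R :> R by rewrite ler0n.
have f1 : f k <= 1 by nra.
have fM : 1 <= f k * (M%:~R + 1) by nra.
rewrite ler_pdivrMr //.
have [pE|pgt0] := posnP p.
  rewrite pE subr0 mul0r addr0 ger0_norm; last by nra.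
  have qq1 : 1 <= q%:R * q%:R :> R by nra.
  have : 1 <= (q%:R * q%:R) * (f k * (M%:~R + 1)) by nra.
  by nra.
have p1 : 1 <= p%:R :> R by rewrite ler1n.
have [b bE] : exists b : nat, a k.+1 = b%:R.
  move: a1; rewrite /a; case: (partial_quotient x k.+1) => b; first by exists b.
  by rewrite NegzE intrN => h; have : 0 <= b.+1%:~R :> R by []; lra.
rewrite bE in a1 aM fE.
have b1 : (0 < b)%N by rewrite -(ltr_nat R); lra.
have bf0 : 0 < b%:R + f k.+1 by lra.
have [qap|apq] := ltnP q (b * p).
  (* The descent stops: p / q lies beyond f k by at least 1 / q. *)
  have qap' : q%:R + 1 <= b%:R * p%:R :> R by rewrite natr1 -natrM ler_nat.
  have F : p%:R - q%:R * f k = (p%:R * (b%:R + f k.+1) - q%:R) * f k.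
    transitivity (p%:R * (f k * (b%:R + f k.+1)) - q%:R * f k); last by ring.
    by rewrite fE mulr1.
  have G : f k <= p%:R - q%:R * f k by rewrite F; nra.
  rewrite distrC ger0_norm; last by lra.
  have qy1 : 1 <= q%:R + p%:R * y by nra.
  have : f k <= (p%:R - q%:R * f k) * (q%:R + p%:R * y).
    by rewrite -[leLHS]mulr1; apply: ler_pM => //; apply: ltW.
  move/(ler_wpM2r (ltW den0)) => h; apply: le_trans h; nra.
have [p' qE] : exists p', q = (b * p + p')%N.
  by exists (q - b * p)%N; rewrite subnKC.
have by0 : 0 < b%:R + y by lra.
have y1itv : 0 <= (b%:R + y)^-1 <= 1.
  by rewrite invr_ge0 invf_le1 //; apply/andP; split; lra.
have qpn' : (p + p' <= n)%N.
  by move: qpn pgt0 (leq_pmull p b1); rewrite qE; clear; lia.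
have := IH k.+1 p p' _ qpn' pgt0 y1itv.
rewrite ler_pdivrMr // => IHk.
have F1 : `|q%:R * f k - p%:R| = f k * `|p%:R * f k.+1 - p'%:R|.
  rewrite -[X in X * `|_|](gtr0_norm f0) -normrM -normrN; congr `|_|.
  rewrite qE natrD natrM.
  transitivity (p%:R * (f k * (b%:R + f k.+1)) -
     (b%:R * p%:R + p'%:R) * f k); first by rewrite fE; ring.
  by ring.
have F2 : q%:R + p%:R * y =
    (b%:R + y) * (p%:R + p'%:R * (b%:R + y)^-1).
  by rewrite qE natrD natrM; field; rewrite gt_eqF.
(* F1, F2, F3 express the invariance of the form under the step. *)
have F3 : 1 + f k * y = f k * (b%:R + y) * (1 + f k.+1 * (b%:R + y)^-1).
  transitivity (f k * (b%:R + f k.+1) + f k * y); first by rewrite fE.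
  by field; rewrite gt_eqF.
rewrite F1 F2 F3.
have /(ler_wpM2l) H : 0 <= f k * (b%:R + y) by apply: mulr_ge0; lra.
apply: (le_trans (H _ _ IHk)); rewrite le_eqVlt; apply/orP; left; apply/eqP.
ring.
Qed.

Lemma bounded_quotients_badly_approximable :
  badly_approximable x (2 * (M%:~R + 1))^-1.
Proof.
have M1 := partial_quotient_bound_ge1.
split=> [|q p q0]; first by rewrite invr_gt0; lra.
have q1 : 1 <= q%:R :> R by rewrite ler1n.
have xE : x = (Num.floor x)%:~R + f 0 by rewrite addrC subrK.
have /andP[f0 f1] : 0 <= f 0 < 1 by exact: frac_part_itv.
pose r := p - q%:Z * Num.floor x.
have -> : q%:R * x - p%:~R = q%:R * f 0 - r%:~R.
  by rewrite {1}xE /r intrB intrM; ring.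
case: r => r.
  have := @continued_fraction_form_lb (q + r) 0 q r 0 (leqnn _) q0.
  rewrite lexx ler01 !mulr0 !addr0 mul1r => /(_ isT) h.
  by rewrite [leRHS]mulrC.
(* A negative numerator is at distance at least 1 from q f >= 0. *)
have : 1 <= `|q%:R * f 0 - (Negz r)%:~R|.
  rewrite NegzE intrN opprK ger0_norm -?natr1.
    have : 0 <= r%:R :> R by rewrite ler0n.
    have : (r.+1%:~R : R) = r%:R + 1 by rewrite natr1.
    by move=> -> ?; nra.
  by apply: addr_ge0; rewrite ?ler0z //; nra.
have : (2 * (M%:~R + 1))^-1 <= 1 :> R by rewrite invf_le1; lra.
by nra.
Qed.
End BoundedQuotients.

(** * Hitting times of quadratic sequences *)

(** Pigeonhole: two of the Q + 1 multiples 0, x, ..., Q x have fractional parts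
    in the same one of Q bins of width 1 / Q. *)
Lemma dirichlet_approximation (R : realType) (x : R) (Q : nat) : (0 < Q)%N ->
  exists (q : nat) (z : int), (0 < q <= Q)%N /\ `|q%:R * x - z%:~R| < Q%:R^-1.
Proof.
case: Q => // Q _.
pose u (k : nat) := Q.+1%:R * frac_part (k%:R * x).
have Qgt0 : 0 < Q.+1%:R :> R by rewrite ltr0n.
have u_itv k : 0 <= u k < Q.+1%:R.
  have /andP[h0 h1] := frac_part_itv (k%:R * x).
  by rewrite /u mulr_ge0 //= -[ltRHS]mulr1 ltr_pM2l.
pose bin (k : 'I_Q.+2) : 'I_Q.+1 := inord (Num.truncn (u k)).
have binE k : bin k = Num.truncn (u k) :> nat.
  have /andP[h0 h1] := u_itv k.
  by rewrite inordK // -(ltr_nat R); apply: le_lt_trans h1; rewrite truncn_le.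
have /injectivePn[i [j nij bij]] : ~~ injectiveb bin.
  by apply/negP => /injectiveP/leq_card; rewrite !card_ord ltnn.
wlog ltij : i j nij bij / (i < j)%N => [hw|].
  case: (ltngtP i j) => [|gtij|eij]; first exact: hw.
    by apply: (hw j i) => //; rewrite eq_sym.
  by move/eqP: nij; case; apply: val_inj.
have uij : `|u j - u i| < 1.
  have := congr1 val bij; rewrite /= !binE => tij.
  have /andP[ui0 _] := u_itv i; have /andP[uj0 _] := u_itv j.
  have /andP[] := truncn_itv ui0; have /andP[] := truncn_itv uj0.
  by rewrite tij -natr1 => *; rewrite ltr_norml; apply/andP; split; lra.
exists (j - i)%N, (Num.floor (j%:R * x) - Num.floor (i%:R * x)).
split; first by have := ltn_ord j; clear -ltij; lia.
have -> : (j - i)%:R * x - (Num.floor (j%:R * x) - Num.floor (i%:R * x))%:~R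
    = (u j - u i) / Q.+1%:R.
  rewrite natrB 1?ltnW // /u /frac_part intrB; field.
  by rewrite gt_eqF // ltr0n.
by rewrite normrM normfV [X in _ / X]gtr0_norm // ltr_pdivrMr // mulVf // gt_eqF.
Qed.

Lemma small_multiple (R : realType) (x e : R) :
  (forall (h : nat) (z : int), (0 < h)%N -> h%:R * x != z%:~R) -> 0 < e ->
  exists (h : nat) (z : int), 0 < `|h%:R * x - z%:~R| < e.
Proof.
move=> irrx e0; pose Q := (Num.truncn e^-1).+1.
have Qe : e^-1 < Q%:R.
  have eV0 : 0 <= e^-1 by rewrite invr_ge0 ltW.
  by have /andP[] := truncn_itv eV0.
have [h [z [/andP[h0 _] hz]]] := @dirichlet_approximation R x Q isT.
exists h, z; rewrite normr_gt0 subr_eq0 irrx //=; apply: (lt_trans hz).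
by rewrite invf_plt ?posrE ?ltr0n.
Qed.

(** A rotation by a small step cannot jump over a target wider than the step,
    and one turn takes at most 1 / |rho| steps; the bound L is uniform in the
    starting point c. *)
Lemma small_step_hits (R : realType) (rho : R) : rho != 0 ->
  exists L : nat, forall c : R, exists (j : nat) (z : int),
    (j < L)%N /\ `|rho * j%:R + c - z%:~R| < `|rho|.
Proof.
wlog rho0 : rho / 0 < rho => [hw|] rhoN0.
  have [pos|neg] := ltP 0 rho; first exact: hw.
  have [||L HL] := hw (- rho); last 1 first.
  exists L => c; have [j [z [jL h]]] := HL (- c).
  exists j, (- z); split=> //; rewrite -normrN -[ltRHS]normrN.
  by congr (`|_| < _): h; rewrite intrN; ring.
  - by rewrite oppr_gt0 lt_neqAle rhoN0.
  - by rewrite oppr_eq0.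
exists (Num.truncn rho^-1).+1 => c; rewrite gtr0_norm //.
have /andP[v0 v1] := frac_part_itv (- c).
have vr0 : 0 <= frac_part (- c) / rho by apply: divr_ge0; lra.
have /andP[] := truncn_itv vr0; rewrite ler_pdivlMr // ltr_pdivrMr //.
set j := Num.truncn _ => jlo jhi.
exists j, (- Num.floor (- c)); split.
  rewrite ltnS; apply: le_truncn; rewrite -[leRHS]mul1r.
  by rewrite ler_wpM2r ?invr_ge0 // ltW.
move: jlo jhi; rewrite -natr1 mulrDl mul1r /frac_part intrN => jlo jhi.
by rewrite ltr_norml; apply/andP; split; lra.
Qed.

(** Multipliers h_0, ..., h_(K-1) are chosen so that each rotation x h_i is much
    slower than the preceding ones: while the slowest stays near its target,
    the others have time to reach all of theirs.  The offsets c, which encode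
    the targets, come after h and L, so both are uniform in them. *)
Lemma simultaneous_hits (R : realType) (x : R) (K : nat) (e : R) :
  (forall (h : nat) (z : int), (0 < h)%N -> h%:R * x != z%:~R) -> 0 < e ->
  exists (h : nat -> nat) (L : nat), forall c : nat -> R,
    exists2 j : nat, (j < L)%N & forall i, (i < K)%N ->
      exists z : int, `|x * (h i)%:R * j%:R + c i - z%:~R| < e.
Proof.
move=> irrx e0; elim: K => [|K [h [L IH]]].
  by exists (fun=> 0%N), 1%N => c; exists 0%N.
have L1 : 0 < L%:R + 1 :> R by rewrite ltr_wpDl.
(* The new rotation moves by less than e over the L + 1 steps that the earlier
   ones may still need once it has come within one step of its target. *)
have [hK [z0 /andP[r0 r1]]] := small_multiple irrx (divr_gt0 e0 L1).
set rho := _ - _ in r0 r1.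
have rhoN0 : rho != 0 by rewrite -normr_gt0.
have [L' HL'] := small_step_hits rhoN0.
exists (fun i => if (i < K)%N then h i else hK), (L' + L)%N => c.
have [j0 [z1 [j0L h0]]] := HL' (c K).
have [j1 j1L h1] := IH (fun i => c i + x * (h i)%:R * j0%:R).
exists (j0 + j1)%N => [|i]; first by lia.
rewrite ltnS leq_eqVlt => /orP[/eqP ->|iK].
  rewrite ltnn; exists (z1 + z0 * (j0 + j1)%:Z).
  have -> : x * hK%:R * (j0 + j1)%:R + c K - (z1 + z0 * (j0 + j1)%:Z)%:~R =
      (rho * j0%:R + c K - z1%:~R) + rho * j1%:R.
    by rewrite intrD intrM natrD /rho -pmulrn natrD; ring.
  have j1L' : j1%:R <= L%:R :> R by rewrite ler_nat ltnW.
  apply: (le_lt_trans (ler_normD _ _)).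
  rewrite normrM normr_nat.
  move: r1; rewrite ltr_pdivlMr // => r1.
  have : `|rho| * j1%:R <= `|rho| * L%:R by rewrite ler_wpM2l.
  by lra.
rewrite iK; have [z hz] := h1 i iK; exists z.
by rewrite natrD; congr (`|_| < _): hz; ring.
Qed.

(** For P(j) = a j^2 + beta j + gamma, the increment P(j + h) - P(j) is an orbit
    of the rotation by 2 a h.  Choosing j by simultaneous_hits with targets
    i / K makes P(j + h_i) close to P(j) + i / K for every i < K, hence
    some P(j + h_i) falls near any prescribed point, whatever P(j) is.  This
    replaces Weyl's equidistribution theorem and is uniform in beta and
    gamma. *)
Lemma quadratic_hits (R : realType) (a tau : R) :
  (forall (h : nat) (z : int), (0 < h)%N -> h%:R * (2 * a) != z%:~R) ->
  0 < tau ->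
  exists L : nat, forall b beta gamma : R, exists (j : nat) (z : int) (t : R),
    [/\ (j < L)%N, 0 < t < tau &
        a * j%:R ^+ 2 + beta * j%:R + gamma = b - t + z%:~R].
Proof.
move=> irra tau0; pose K := (Num.truncn (4 / tau)).+1.
have K0 : 0 < K%:R :> R by rewrite ltr0n.
have KV : K%:R^-1 < tau / 4.
  rewrite -[tau / 4]invrK ltf_pV2 ?posrE ?invr_gt0; last 2 first.
  - by [].
  - lra.
  have h0 : 0 <= 4 / tau by apply: divr_ge0; lra.
  by have /andP[_] := truncn_itv h0; rewrite invf_div.
have tau4 : 0 < tau / 4 by lra.
have [h [L HL]] := simultaneous_hits K irra tau4.
exists (L + \max_(i < K) h i)%N => b beta gamma.
have [j jL hj] :=
  HL (fun i => a * (h i)%:R ^+ 2 + beta * (h i)%:R - i%:R / K%:R).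
pose P (n : nat) := a * n%:R ^+ 2 + beta * n%:R + gamma.
(* The target is the middle of the arc (b - tau, b); the rounding of v to a
   multiple of 1 / K and the errors of HL each cost less than tau / 4. *)
pose v := b - tau / 2 - P j.
have /andP[v0 v1] := frac_part_itv v.
have Kv0 : 0 <= K%:R * frac_part v by apply: mulr_ge0 => //; apply: ltW.
pose i := Num.truncn (K%:R * frac_part v).
have /andP[ilo ihi] := truncn_itv Kv0.
rewrite -/i -natr1 in ilo ihi.
have iK : (i < K)%N.
  rewrite -(ltr_nat R); apply: (le_lt_trans ilo).
  by rewrite -[ltRHS]mulr1 ltr_pM2l.
have [z] := hj i iK; rewrite ltr_norml => /andP[elo ehi].
exists (j + h i)%N, (z - Num.floor v).
exists (b - P (j + h i)%N + (z - Num.floor v)%:~R).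
split; last by rewrite /P; ring.
  have hle := @leq_bigmax _ (fun l : 'I_K => h l) (Ordinal iK).
  by rewrite -addSn leq_add.
have ilo' : i%:R / K%:R <= frac_part v by rewrite ler_pdivrMr // mulrC.
have ihi' : frac_part v < i%:R / K%:R + K%:R^-1.
  by rewrite -[X in _ + X]div1r -mulrDl ltr_pdivlMr // mulrC.
have -> : b - P (j + h i)%N + (z - Num.floor v)%:~R =
    tau / 2 + (frac_part v - i%:R / K%:R) -
    (2 * a * (h i)%:R * j%:R +
     (a * (h i)%:R ^+ 2 + beta * (h i)%:R - i%:R / K%:R) - z%:~R).
  by rewrite /frac_part intrB /v /P natrD; field; rewrite gt_eqF.
by apply/andP; split; lra.
Qed.

(** * Separating x_k from x_(k+n) *)

(** D (k + q) - D k and q theta - z0 agree mod 1, and their difference is less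
    than 2 c + (1 - 2 c) = 1 in absolute value, so they are equal: an orbit
    confined to [-c, c] does not wrap around the circle. *)
Lemma confined_rotation (R : realType) (theta phi c : R) (D : nat -> R)
    (m q : nat) (z0 : int) :
  (forall k, (k <= m)%N -> `|D k| <= c) ->
  (forall k, (k <= m)%N -> exists z : int, theta * k%:R + phi = D k + z%:~R) ->
  `|q%:R * theta - z0%:~R| < 1 - 2 * c ->
  forall i k, (k + i * q <= m)%N ->
    D (k + i * q)%N = D k + i%:R * (q%:R * theta - z0%:~R).
Proof.
move=> Dc Dmod rho_small; set rho := _ - _ in rho_small *.
have step k : (k + q <= m)%N -> D (k + q)%N = D k + rho.
  move=> kqm; have km : (k <= m)%N by apply: leq_trans kqm; rewrite leq_addr.
  have [z1 E1] := Dmod _ km; have [z2 E2] := Dmod _ kqm.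
  have := Dc _ km; have := Dc _ kqm; move: rho_small.
  rewrite !ler_norml ltr_norml => /andP[r1 r2] /andP[d1 d2] /andP[d3 d4].
  have E : D (k + q)%N - D k - rho = (z1 + z0 - z2)%:~R.
    move: E1 E2; rewrite natrD intrB intrD /rho => E1 E2.
    by apply/eqP; rewrite -subr_eq0; apply/eqP; move: E1 E2; lra.
  have Z0 : `|z1 + z0 - z2| < 1.
    rewrite -(ltr_int R) intr_norm -E ltr_norml; apply/andP; split; lra.
  have {}Z0 : z1 + z0 - z2 = 0 by move: Z0; clear; lia.
  by move: E; rewrite Z0 => E; lra.
elim=> [|i IH] k; first by rewrite addn0 mul0r addr0.
rewrite mulSn [(q + _)%N]addnC addnA => kim.
rewrite step // IH; first by rewrite -natr1; ring.
by apply: leq_trans kim; rewrite leq_addr.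
Qed.

(** In this section S u v abstracts the relation that u and v lie mod 1 in the
    same interval, and b, w are the right end and the length of one chosen
    interval: a point within w before b is separated from its translates by more
    than its distance to b, as long as the translation stays below 1/2. *)
Section Separation.
Variables (R : realType) (a kappa c b w : R) (S : R -> R -> Prop).
Hypothesis a_bad : badly_approximable a kappa.
Hypothesis c_itv : 0 <= c < 2^-1.
Hypothesis w_gt0 : 0 < w.
Hypothesis S_sym : forall u v, S u v -> S v u.
Hypothesis S_close : forall u v, S u v ->
  exists2 d : R, `|d| <= c & exists z : int, v - u = d + z%:~R.
Hypothesis S_split : forall (t d : R) (z z' : int), 0 < t < w -> t < d <= c ->
  ~ S (b - t + z%:~R) (b - t + d + z'%:~R).

Lemma badly_approximable_multiple_neq_int (k h : nat) (z : int) :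
  (0 < k)%N -> (0 < h)%N -> h%:R * (k%:R * a) != z%:~R.
Proof.
move=> k0 h0; apply/eqP => E; have [kap0 /(_ (h * k)%N z)] := a_bad.
rewrite muln_gt0 h0 k0 -E mulrA -natrM subrr normr0 mulr0 => /(_ isT).
by rewrite leNgt kap0.
Qed.

Definition quad (beta gamma : R) (k : nat) : R :=
  a * k%:R ^+ 2 + beta * k%:R + gamma.

(** The core of the argument.  All of Q, W, delta, tau, L depend only on a,
    kappa, c, w, eps; then n is taken large, uniformly in beta and gamma. *)
Lemma separated_pair (eps : R) : 0 < eps -> exists n0 : nat,
  forall (n : nat) (beta gamma : R), (n0 <= n)%N ->
    exists k : nat, [/\ (0 < k)%N, k%:R <= eps * n%:R &
      ~ S (quad beta gamma k) (quad beta gamma (k + n))].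
Proof.
move=> eps0; have [kap0 Ha] := a_bad; have /andP[c0 c1] := c_itv.
pose Q := (Num.truncn (1 - 2 * c)^-1).+1.
have gap0 : 0 < 1 - 2 * c by lra.
have Qgap : Q%:R^-1 < 1 - 2 * c.
  have gapV0 : 0 <= (1 - 2 * c)^-1 by rewrite invr_ge0 ltW.
  by rewrite invf_plt ?posrE ?ltr0n //; have /andP[] := truncn_itv gapV0.
have [W W0 dvdW] :
    exists2 W : nat, (0 < W)%N & forall q, (0 < q <= Q)%N -> (q %| W)%N.
  by exists Q`! => [|q qQ]; [exact: fact_gt0 | exact: dvdn_fact].
have W1 : 1 <= W%:R :> R by rewrite ler1n.
have WR0 : 0 < W%:R :> R by lra.
(* Half of the guaranteed drift of E_j; see the assertion drift below. *)
pose delta := eps * kappa / (16 * W%:R ^+ 2).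
have delta0 : 0 < delta.
  by rewrite divr_gt0 ?mulr_gt0 ?exprn_gt0.
pose tau := Num.min w (delta / 2).
have tau0 : 0 < tau by rewrite lt_min w_gt0 /=; lra.
have irr (h : nat) (z : int) :
    (0 < h)%N -> h%:R * (2 * (a * W%:R ^+ 2)) != z%:~R.
  move=> h0; have -> : 2 * (a * W%:R ^+ 2) = (2 * W ^ 2)%:R * a.
    by rewrite natrM natrX; ring.
  by apply: badly_approximable_multiple_neq_int; rewrite // muln_gt0 expn_gt0 W0.
have [L HL] := quadratic_hits irr tau0.
(* The first term leaves room for runs of length L, the second one makes E_j
   vary by at most delta / 2 along such a run. *)
pose B := 4 * W%:R * (L%:R + 1) + 8 * W%:R * L%:R / delta.
have L0 : 0 <= L%:R :> R by [].
have B2 : 0 <= 8 * W%:R * L%:R / delta.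
  by apply: divr_ge0; [nra | apply: ltW].
have B0 : 0 <= B / eps by apply: divr_ge0; [rewrite /B; nra | apply: ltW].
exists (Num.truncn (B / eps)).+1 => n beta gamma n0n.
have Bn : B < eps * n%:R.
  rewrite mulrC -ltr_pdivrMr //; have /andP[_ h] := truncn_itv B0.
  by apply: (lt_le_trans h); rewrite ler_nat.
apply: contrapT => noSep.
have allS k : (0 < k)%N -> k%:R <= eps * n%:R ->
    S (quad beta gamma k) (quad beta gamma (k + n)).
  by move=> k0 kn; apply: contrapT => nS; apply: noSep; exists k.
have n1 : (0 < n)%N by apply: leq_trans n0n.
have nR0 : 0 < n%:R :> R by rewrite ltr0n.
pose theta := 2 * a * n%:R.
pose phi := 2 * a * n%:R + a * n%:R ^+ 2 + beta * n%:R.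
have diffE k : quad beta gamma (k.+1 + n) - quad beta gamma k.+1 =
    theta * k%:R + phi.
  by rewrite /quad /theta /phi natrD -natr1; ring.
have : forall k, exists d : R, k.+1%:R <= eps * n%:R ->
    `|d| <= c /\ exists z : int, theta * k%:R + phi = d + z%:~R.
  move=> k; have [kn|nk] := pselect (k.+1%:R <= eps * n%:R); last by exists 0.
  by have [d dc dz] := S_close (allS k.+1 isT kn); exists d; rewrite -diffE.
move=> /choice[D HD].
pose J := Num.truncn (eps * n%:R / (2 * W%:R)).
have Jarg0 : 0 <= eps * n%:R / (2 * W%:R) by apply: divr_ge0; nra.
have /andP[Jlo Jhi] := truncn_itv Jarg0.
rewrite -/J -natr1 ler_pdivlMr ?ltr_pdivrMr in Jlo Jhi; [|lra|lra].
have WJ : (W * J)%:R + 1 <= eps * n%:R.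
  by rewrite natrM; rewrite /B in Bn; nra.
have Dok k : (k <= W * J)%N -> k.+1%:R <= eps * n%:R.
  by move=> kWJ; apply: le_trans WJ; rewrite natr1 ler_nat.
have [q [z0 [qQ qz]]] := @dirichlet_approximation R theta Q isT.
have /dvdnP[r WE] : (q %| W)%N by apply: dvdW.
pose sigma := r%:R * (q%:R * theta - z0%:~R).
have DE j k : (k + j <= J)%N -> D (W * (k + j))%N = D (W * k)%N + j%:R * sigma.
  move=> kjJ; rewrite mulnDr {2}WE [(r * q)%N]mulnC -mulnA [(q * _)%N]mulnC.
  rewrite (@confined_rotation R theta phi c D (W * J) q z0).
  - by rewrite natrM /sigma; ring.
  - by move=> i /Dok/HD[].
  - by move=> i /Dok/HD[].
  - exact: lt_trans Qgap.
  - by rewrite mulnAC -WE -mulnDr leq_mul2l kjJ orbT.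
have Dc j : (j <= J)%N -> `|D (W * j)%N| <= c.
  by move=> jJ; have [] := HD _ (Dok (W * j)%N _); rewrite ?leq_mul2l ?jJ ?orbT.
have sigma_lb : kappa <= 2 * n%:R * W%:R * `|sigma|.
  have := Ha (2 * n * W)%N (r%:Z * z0).
  rewrite muln_gt0 W0 muln_gt0 n1 => /(_ isT) h; apply: (le_trans h).
  rewrite !natrM intrM -pmulrn le_eqVlt; apply/orP; left; apply/eqP.
  by congr (_ * `|_|); rewrite /sigma /theta WE natrM; ring.
have sigma_ub : J%:R * `|sigma| < 1.
  have := DE J 0%N (leqnn _); have := Dc 0%N isT; have := Dc J (leqnn _).
  rewrite add0n => h1 h2 h3; rewrite -(normr_nat R J) -normrM.
  have -> : J%:R * sigma = D (W * J)%N - D (W * 0)%N by rewrite h3; ring.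
  by apply: le_lt_trans (ler_normB _ _) _; lra.
have sigma0 : 0 <= `|sigma| by [].
have N_lb : 4 * W%:R * (L%:R + 1) <= eps * n%:R by rewrite /B in Bn; lra.
have LJ : eps * n%:R <= 4 * W%:R * (J%:R - L%:R) by nra.
have leLJ : (L <= J)%N by rewrite -(ler_nat R); nra.
have drift : 2 * delta <= (J - L)%:R * `|sigma|.
  rewrite natrB //.
  have h1 : eps * n%:R * `|sigma| <= 4 * W%:R * (J%:R - L%:R) * `|sigma|.
    by rewrite ler_wpM2r.
  have h2 : eps * kappa <= eps * (2 * n%:R * W%:R * `|sigma|).
    by rewrite ler_wpM2l // ltW.
  have -> : 2 * delta = eps * kappa / (8 * W%:R ^+ 2).
    by rewrite /delta; field; rewrite gt_eqF.
  rewrite ler_pdivrMr; last by rewrite mulr_gt0 ?exprn_gt0.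
  have : 2 * W%:R * (eps * n%:R * `|sigma|) <=
         2 * W%:R * (4 * W%:R * (J%:R - L%:R) * `|sigma|).
    by rewrite ler_wpM2l // mulr_ge0.
  by move: h2; lra.
have wobble j : (j < L)%N -> `|j%:R * sigma| <= delta / 2.
  move=> /ltnW jL; rewrite normrM normr_nat.
  apply: (@le_trans _ _ (L%:R * `|sigma|)); first by rewrite ler_wpM2r ?ler_nat.
  have h1 : 8 * W%:R * L%:R / delta <= eps * n%:R.
    by rewrite /B in Bn; nra.
  have h2 : eps * n%:R * `|sigma| <= 4 * W%:R.
    apply: (@le_trans _ _ (4 * W%:R * (J%:R - L%:R) * `|sigma|)).
      by rewrite ler_wpM2r.
    have Js : (J%:R - L%:R) * `|sigma| <= 1.
      by have := mulr_ge0 L0 sigma0; lra.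
    by rewrite -mulrA -[leRHS]mulr1 ler_wpM2l // mulr_ge0.
  have h3 : 8 * W%:R * L%:R / delta * `|sigma| <= 4 * W%:R.
    by apply: le_trans h2; rewrite ler_wpM2r.
  rewrite mulrAC ler_pdivrMr // in h3.
  rewrite -(@ler_pM2l _ (8 * W%:R)); last by lra.
  by lra.
(* E_0 and E_(J - L) differ by at least 2 delta, so one of them is large. *)
have [j0 [j0L D0]] : exists j0, (j0 + L <= J)%N /\ delta <= `|D (W * j0)%N|.
  have [h|h] := leP delta `|D (W * 0)%N|; first by exists 0%N.
  exists (J - L)%N; rewrite subnK //; split=> //.
  have := DE (J - L)%N 0%N; rewrite add0n => /(_ (leq_subr _ _)) ->.
  have := ler_normB (D (W * 0)%N + (J - L)%:R * sigma) (D (W * 0)%N).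
  by rewrite addrAC subrr add0r normrM normr_nat; lra.
pose s := (W * j0).+1.
have quad_s v j : quad beta gamma (s + v + W * j) =
    a * W%:R ^+ 2 * j%:R ^+ 2 +
    (2 * a * W%:R * (s + v)%:R + beta * W%:R) * j%:R + quad beta gamma (s + v).
  by rewrite /quad [in LHS]natrD [in LHS]natrM; ring.
have pair j : (j < L)%N -> exists (d : R) (z : int),
    [/\ `|d| <= c, d = D (W * j0)%N + j%:R * sigma,
      S (quad beta gamma (s + 0 + W * j)) (quad beta gamma (s + n + W * j)) &
      quad beta gamma (s + n + W * j) =
      quad beta gamma (s + 0 + W * j) + d + z%:~R].
  move=> jL; have jJ : (j0 + j <= J)%N by move: j0L jL; clear; lia.
  have kE v : (s + v + W * j = (W * (j0 + j)).+1 + v)%N.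
    by rewrite /s mulnDr; clear; lia.
  have kok : (W * (j0 + j) <= W * J)%N by rewrite leq_mul2l jJ orbT.
  have [dc [z zE]] := HD _ (Dok _ kok).
  exists (D (W * (j0 + j))%N), z; rewrite !kE addn0; split=> //.
  - exact: DE.
  - by apply: allS => //; apply: Dok.
  - by rewrite -addrA -zE -diffE addrC subrK.
have tau_w t : 0 < t < tau -> 0 < t < w /\ t < delta / 2.
  by rewrite lt_min => /andP[-> /andP[-> ->]].
(* The point sent to the left of b is the one from which the other is reached
   by a positive translation: x_k if E_j > 0, x_(k+n) if E_j < 0. *)
have [Dpos|Dneg] := leP 0 (D (W * j0)%N).
  rewrite ger0_norm // in D0.
  have [j [z [t [jL /tau_w[tw td] jE]]]] := HL b
    (2 * a * W%:R * (s + 0)%:R + beta * W%:R) (quad beta gamma (s + 0)).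
  have [d [z' [dc dE Sd vE]]] := pair _ jL.
  have := wobble _ jL; rewrite ler_norml => /andP[wob _].
  move: dc; rewrite ler_norml => /andP[_ dc].
  rewrite -quad_s in jE; rewrite vE jE in Sd.
  apply: (@S_split t d z (z + z') tw); first by apply/andP; split; lra.
  by congr (S _ _): Sd; rewrite intrD; ring.
rewrite ltr0_norm // in D0.
have [j [z [t [jL /tau_w[tw td] jE]]]] := HL b
  (2 * a * W%:R * (s + n)%:R + beta * W%:R) (quad beta gamma (s + n)).
have [d [z' [dc dE Sd vE]]] := pair _ jL.
have := wobble _ jL; rewrite ler_norml => /andP[_ wob].
move: dc; rewrite ler_norml => /andP[dc _].
rewrite -quad_s in jE.
apply: (@S_split t (- d) z (z - z') tw); first by apply/andP; split; lra.
apply: S_sym; congr (S _ _): Sd; last exact: jE.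
by move: vE; rewrite jE intrB; lra.
Qed.
End Separation.

(** * Limits superior of recurrence quotients *)

Lemma limn_esup_eq1 (R : realType) (u : nat -> \bar R) :
  (forall n, 1 <= u n)%E ->
  (forall e : R, 0 < e -> exists n0 : nat, forall n, (n0 <= n)%N ->
     (u n <= 1 + e%:E)%E) ->
  limn_esup u = 1%E.
Proof.
move=> u_ge1 u_le; apply/le_anti/andP; split.
  apply/lee_addgt0Pr => e /u_le[n0 Hn0].
  apply: (@le_trans _ _ (ereal_sup (u @` [set n | (n0 <= n)%N]))).
    by apply: ereal_inf_lbound; exists [set n | (n0 <= n)%N] => //; exists n0.
  by apply: ge_ereal_sup => _ [n nn0 <-]; apply: Hn0.
apply: le_ereal_inf_tmp => _ [V [n0 _ Vn0] <-].
apply: (le_trans (u_ge1 n0)).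
by apply: ereal_sup_ubound; exists n0 => //; apply: Vn0 => /=.
Qed.

Lemma limn_esup_sup_pos (R : realType) (P : nat -> nat -> Prop) :
  (forall e : R, 0 < e -> exists n0 : nat, forall n m, (n0 <= n)%N ->
     (0 < m)%N -> P n m -> m%:R <= e * n%:R) ->
  limn_esup (fun n => (1 + (n%:R^-1)%:E * sup_pos R (P n))%E) = 1%E.
Proof.
move=> P_le; have sup_ge0 n : (0 <= sup_pos R (P n))%E.
  by rewrite /sup_pos le_max lexx.
apply: limn_esup_eq1 => [n|e e0].
  by rewrite leeDl // mule_ge0 // lee_fin invr_ge0.
have [n0 Hn0] := P_le e e0; exists n0.+1 => n n0n.
have nR0 : 0 < n%:R :> R by rewrite ltr0n; apply: leq_trans n0n.
rewrite leeD2l //; apply: (@le_trans _ _ ((n%:R^-1)%:E * (e * n%:R)%:E)%E).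
  apply: lee_wpmul2l; first by rewrite lee_fin invr_ge0.
  rewrite /sup_pos ge_max lee_fin mulr_ge0 ?(ltW e0) //=.
  apply: ge_ereal_sup => _ [m [m0 Pm] <-]; rewrite lee_fin.
  by apply: (Hn0 n) => //; apply: ltnW.
by rewrite -EFinM lee_fin mulrC mulfK // gt_eqF.
Qed.

(** * Codings on the circle *)

Lemma to_circleMn (R : realType) (x : R) (n : nat) :
  to_circle (x *+ n) = to_circle x *+ n.
Proof.
elim: n => [|n IH]; last by rewrite !mulrS to_circleD IH.
by rewrite !mulr0n; apply: (addIr (to_circle 0)); rewrite -to_circleD !add0r.
Qed.

Lemma to_circle_surj (R : realType) (y : circle R) :
  exists x : R, to_circle x = y.
Proof. by exists (repr y); apply: reprK. Qed.

Lemma eq_to_circleP (R : realType) (x y : R) :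
  to_circle x = to_circle y <-> exists z : int, x = y + z%:~R.
Proof.
rewrite eq_to_circle; split=> [/intrP[z E]|[z ->]].
  by exists z; rewrite -E addrC subrK.
by rewrite addrAC subrr add0r intr_int.
Qed.

Lemma to_circle_quad (R : realType) (a b g : R) (k : nat) :
  to_circle (quad a b g k) =
  to_circle a *~ (k%:Z ^+ 2) + to_circle b *~ k%:Z + to_circle g.
Proof.
rewrite /quad !to_circleD -natrX !mulr_natr !to_circleMn.
by rewrite -[k%:Z ^+ 2](rmorphXn Posz).
Qed.

(** Only the closed hull and the interior of an arc matter below, so the choice
    of open or closed ends is forgotten here. *)
Lemma arc_itvP (R : realType) (A : set (circle R)) (len : R) : is_arc A len ->
  exists a : R,
    (forall x, A (to_circle x) ->
       exists2 u, a <= u <= a + len & exists z : int, x = u + z%:~R) /\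
    (forall u, a < u < a + len -> A (to_circle u)).
Proof.
move=> [_ [a [ba [bb ->]]]]; exists a; split=> [x [u + ux]|u /andP[au ub]].
  rewrite /= in_itv /= => uI; exists u; last exact/eq_to_circleP.
  by case: ba bb uI => -[] /= /andP[? ?]; apply/andP; split; lra.
exists u => //=; rewrite in_itv /=.
by case: ba bb => -[]; rewrite /= ?au ?ub ?(ltW au) ?(ltW ub).
Qed.

(** Arcs of length 0 are points, and N points do not cover the N + 1 classes of
    i / (N + 1). *)
Lemma arc_len_gt0 (R : realType) (N : nat) (J : 'I_N -> set (circle R))
    (len : 'I_N -> R) :
  cover [set: 'I_N] J = [set: circle R] ->
  (forall l, is_arc (J l) (len l)) -> exists l, 0 < len l.
Proof.
move=> Jcover Jarc; apply: contrapT => len0.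
pose pt (i : 'I_N.+1) : R := i%:R / N.+1%:R.
have /choice[f Hf] : forall i, exists l, J l (to_circle (pt i)).
  move=> i; have : [set: circle R] (to_circle (pt i)) by [].
  by rewrite -Jcover => -[l _ Jl]; exists l.
have /injectivePn[i [j nij fij]] : ~~ injectiveb f.
  by apply/negP => /injectiveP/leq_card; rewrite !card_ord ltnn.
have [a [arc_sub _]] := arc_itvP (Jarc (f i)).
have lenf : len (f i) <= 0.
  by rewrite leNgt; apply/negP => h; apply: len0; exists (f i).
have [u uI [z uE]] := arc_sub _ (Hf i).
have := Hf j; rewrite -fij => /arc_sub[v vI [z' vE]].
have Z : pt i - pt j = (z - z')%:~R by rewrite uE vE intrB; lra.
have pt_itv k : 0 <= pt k < 1.
  by rewrite divr_ge0 //= ltr_pdivrMr ?ltr0n // mul1r ltr_nat.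
have : `|z - z'| < 1.
  have := pt_itv i; have := pt_itv j.
  rewrite -(ltr_int R) intr_norm -Z ltr_norml => /andP[? ?] /andP[? ?].
  by apply/andP; split; lra.
have : z - z' != 0.
  rewrite -(intr_eq0 R) -Z subr_eq0 /pt; apply: contra nij => /eqP.
  move/(mulIf _) => /(_ _)/eqP; rewrite invr_eq0 pnatr_eq0 /= => /(_ isT).
  by rewrite eqr_nat.
by clear; lia.
Qed.

Section Coding.
Variables (R : realType) (N : nat) (J : 'I_N -> set (circle R)).
Variables (lambda : 'I_N -> R).
Hypothesis J_partition : partition [set: 'I_N] J [set: circle R].
Hypothesis lambda_inj : injective lambda.

Lemma quadratic_coding_val alpha beta gamma n l :
  J l (alpha *~ (n ^+ 2) + beta *~ n + gamma) ->
  quadratic_coding J lambda alpha beta gamma n = lambda l.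
Proof.
have [_ Jtriv _] := J_partition.
move=> Jl; rewrite /quadratic_coding (bigD1 l) //= indicE mem_set // mulr1.
rewrite big1 ?addr0 // => l' /eqP nl; rewrite indicE memNset ?mulr0 // => Jl'.
by apply: nl; apply: Jtriv => //; exists (alpha *~ (n ^+ 2) + beta *~ n + gamma).
Qed.

Lemma eq_quadratic_coding alpha beta gamma n n' :
  quadratic_coding J lambda alpha beta gamma n =
    quadratic_coding J lambda alpha beta gamma n' ->
  exists l, J l (alpha *~ (n ^+ 2) + beta *~ n + gamma) /\
            J l (alpha *~ (n' ^+ 2) + beta *~ n' + gamma).
Proof.
have [Jcover _ _] := J_partition.
have inJ y : exists l, J l y.
  have : [set: circle R] y by [].
  by rewrite -Jcover => -[l _ Jl]; exists l.
have [l Jl] := inJ (alpha *~ (n ^+ 2) + beta *~ n + gamma).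
have [l' Jl'] := inJ (alpha *~ (n' ^+ 2) + beta *~ n' + gamma).
rewrite (quadratic_coding_val Jl) (quadratic_coding_val Jl') => /lambda_inj ll'.
by exists l; rewrite {2}ll'.
Qed.

Hypothesis J_short :
  forall l : 'I_N, exists2 len : R, is_arc (J l) len & len < 2^-1.
Variable alpha : circle R.
Hypothesis alpha_bpq : bounded_partial_quotients alpha.

(** Applies separated_pair to the relation of sharing an interval; the chosen
    interval is any one of positive length. *)
Lemma coding_mismatch beta gamma (e : R) : 0 < e ->
  let omega := quadratic_coding J lambda alpha beta gamma in
  exists n0 : nat, forall n : nat, (n0 <= n)%N ->
    exists k : nat, [/\ (0 < k)%N, k%:R <= e * n%:R &
      omega k%:Z <> omega (k%:Z + n%:Z)].
Proof.
move=> e0 omega; have [a [aE a_irr [M a_bound]]] := alpha_bpq.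
have a_bad := bounded_quotients_badly_approximable a_irr a_bound.
have [b bE] := to_circle_surj beta; have [g gE] := to_circle_surj gamma.
have [Jcover Jtriv _] := J_partition.
have /choice[len Hlen] : forall l, exists r : R, is_arc (J l) r /\ r < 2^-1.
  by move=> l; have [r h1 h2] := J_short l; exists r.
have Jarc l : is_arc (J l) (len l) by have [] := Hlen l.
pose c := \big[Num.max/0]_l len l.
have c_itv : 0 <= c < 2^-1.
  rewrite bigmax_ge_id /=; apply: bigmax_lt => [|l _]; last by have [] := Hlen l.
  by rewrite invr_gt0.
have lenc l : len l <= c by apply: le_bigmax.
have [l0 len_l0] := arc_len_gt0 Jcover Jarc.
have [a0 [arc_sub arc_sup]] := arc_itvP (Jarc l0).
pose S u v := exists l, J l (to_circle u) /\ J l (to_circle v).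
have S_sym u v : S u v -> S v u by move=> [l []]; exists l.
have S_close u v : S u v ->
    exists2 d : R, `|d| <= c & exists z : int, v - u = d + z%:~R.
  move=> [l [Ju Jv]]; have [al [sub_l _]] := arc_itvP (Jarc l).
  have [u' /andP[u1 u2] [z uE]] := sub_l _ Ju.
  have [v' /andP[v1 v2] [z' vE]] := sub_l _ Jv.
  exists (v' - u'); last by exists (z' - z); rewrite uE vE intrB; ring.
  by have := lenc l; rewrite ler_norml => hl; apply/andP; split; lra.
have S_split (t d : R) (z z' : int) : 0 < t < len l0 -> t < d <= c ->
    ~ S (a0 + len l0 - t + z%:~R) (a0 + len l0 - t + d + z'%:~R).
  move=> /andP[t0 t1] /andP[td dc] [l [Jl]].
  have Jl0 : J l0 (to_circle (a0 + len l0 - t + z%:~R)).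
    have -> : to_circle (a0 + len l0 - t + z%:~R) = to_circle (a0 + len l0 - t).
      by apply/eq_to_circleP; exists z.
    by apply: arc_sup; apply/andP; split; lra.
  have -> : l = l0.
    by apply: Jtriv => //; exists (to_circle (a0 + len l0 - t + z%:~R)).
  move=> /arc_sub[v /andP[v1 v2] [y yE]].
  have /andP[_ c1] := c_itv; have := lenc l0 => len_c.
  (* The integer z' - y would lie strictly between -1 and 0: the translate is
     past the right end b, but short of the left end one turn later. *)
  have yz : (z' - y)%:~R = v - (a0 + len l0 - t + d) :> R.
    by rewrite intrB; lra.
  have : z' - y < 0 by rewrite -(ltr_int R) yz; lra.
  have : -1 < z' - y by rewrite -(ltr_int R) yz intrN; lra.
  by clear; lia.
have [n0 Hn0] := separated_pair a_bad c_itv len_l0 S_sym S_close S_split e0.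
exists n0 => n n0n; have [k [k0 ke nS]] := Hn0 n b g n0n.
exists k; split=> // /eq_quadratic_coding[l [Jk Jkn]]; apply: nS; exists l.
rewrite !to_circle_quad aE bE gE; split; first exact: Jk.
by rewrite PoszD.
Qed.
End Coding.

Theorem theorem6 (R : realType) (N : nat)
    (J : 'I_N -> set (circle R)) (lambda : 'I_N -> R) (alpha : circle R)
    (J_partition : classical_sets.partition [set: 'I_N] J [set: circle R])
    (J_short : forall l : 'I_N, exists2 len : R, is_arc (J l) len & len < 2^-1)
    (lambda_distinct : injective lambda)
    (alpha_bpq : bounded_partial_quotients alpha) :
  forall beta gamma : circle R,
    R_exponent R (quadratic_coding J lambda alpha beta gamma) = 1%E /\
    T_exponent R (quadratic_coding J lambda alpha beta gamma) = 1%E.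
Proof.
move=> beta gamma.
have mismatch e e0 := coding_mismatch J_partition lambda_distinct J_short
  alpha_bpq beta gamma (e := e) e0.
have bound (P : nat -> nat -> Prop) :
    (forall n m, P n m -> forall k : int, (1 <= k <= m%:Z)%R ->
       quadratic_coding J lambda alpha beta gamma k =
       quadratic_coding J lambda alpha beta gamma (k + n%:Z)) ->
    limn_esup (fun n => (1 + (n%:R^-1)%:E * sup_pos R (P n))%E) = 1%E.
  move=> P_rec; apply: limn_esup_sup_pos => e /mismatch[n0 Hn0].
  exists n0 => n m n0n _ /P_rec Pnm.
  have [k [k0 ke]] := Hn0 n n0n.
  rewrite leNgt => neq; apply/negP => em; apply: neq; apply: Pnm.
  by rewrite !lez_nat k0 /= -(ler_nat R) ltW // (le_lt_trans ke).
split; apply: bound => n m H k k_itv; first exact: H.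
by have [] := H k k_itv.
Qed.
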